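(* There exist absolute constants $C, c > 0$ (in particular, independent of the dimension) such that, for every dimension $d \geq 1$, every pair of convex bodies $G$ and $K$ in $\mathbb{R}^d$ satisfying $0 \in \operatorname{int} G$ and $G \subset \operatorname{int} K$, and every $\alpha > 0$, $$\widehat{M}_H(G, K; \alpha) \;\leq\; C \cdot \widehat{M}_H(K^\circ, G^\circ; c\alpha)^2 \, M_H(K^\circ, G^\circ; c\alpha).$$
   Context: A convex body in $\mathbb{R}^d$ is a compact convex set with nonempty interior. For nonempty $S \subset \mathbb{R}^d$, its polar is $S^\circ = \{ y \in \mathbb{R}^d : \langle x, y\rangle \leq 1 \text{ for all } x \in S\}$. If $0 \in \operatorname{int} G$ and $G \subset \operatorname{int} K$, then $K^\circ, G^\circ$ are convex bodies with $0 \in \operatorname{int} K^\circ$ and $K^\circ \subset \operatorname{int} G^\circ$. Hilbert metric: for a convex body $L \subset \mathbb{R}^d$ with $0 \in \operatorname{int} L$ and $y \in \mathbb{R}^d$, write $f_y(x) = 1 - \langle y, x\rangle$. For $x_1, x_2 \in \operatorname{int} L$, $$\operatorname{dist}^H_L(x_1,x_2) = \frac12 \sup_{y,z \in L^\circ} \log\left( \frac{f_y(x_1)}{f_y(x_2)} \cdot \frac{f_z(x_2)}{f_z(x_1)} \right).$$ For nonempty $C \subset \operatorname{int} L$ and $x \in \operatorname{int} L$, $\operatorname{dist}^H_L(x, C) = \operatorname{dist}^H_L(C,x) = \inf_{c \in C} \operatorname{dist}^H_L(x,c)$. Packing numbers: let $S$ be a nonempty compact subset of $\operatorname{int} L$ and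 $\alpha > 0$. The Hilbert packing number $M_H(S, L; \alpha)$ is the maximum integer $N$ for which there exist $x_1, \dots, x_N \in S$ with $\operatorname{dist}^H_L(x_i,x_j) \geq \alpha$ for all $1 \leq i < j \leq N$. The Hilbert convexified packing number $\widehat{M}_H(S, L; \alpha)$ is the maximum integer $N$ for which there exists a sequence $x_1,\dots,x_N \in S$ with $\operatorname{dist}^H_L(x_j, \operatorname{conv}\{x_1,\dots,x_{j-1}\}) \geq \alpha$ for all $2 \leq j \leq N$. Both numbers are finite for every $\alpha>0$. *)

(* Defs.v *)
From mathcomp Require Import all_boot all_order all_algebra.
From mathcomp Require Import all_classical all_reals all_analysis.

Set Implicit Arguments.
Unset Strict Implicit.
Unset Printing Implicit Defensive.

Import Order.TTheory GRing.Theory Num.Theory.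
Import numFieldNormedType.Exports.

Local Open Scope classical_set_scope.
Local Open Scope ring_scope.

Section ConvexBodies.
Context {R : realType} {d : nat}.
Implicit Types (x y z : 'rV[R]_d) (S K : set 'rV[R]_d).

Definition dotrv x y : R := \sum_(i < d) x ord0 i * y ord0 i.

(* The norm on row vectors is the sup norm; being equivalent to the Euclidean
   one, it gives the same compact sets and the same interiors. *)
Definition convex_body K := [/\ compact K, convex_set K & K° !=set0].

Definition polar S : set 'rV[R]_d := [set y | forall x, S x -> dotrv x y <= 1].

Definition convex_hull S : set 'rV[R]_d := smallest (@convex_set R _) S.

End ConvexBodies.

Section HilbertMetric.
Context {R : realType} {d : nat}.
Implicit Types (x y z : 'rV[R]_d) (S L C : set 'rV[R]_d).

Definition polar_fun y x : R := 1 - dotrv y x.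

(* For x1, x2 in the interior of a convex body L with 0 in its interior, the
   logarithms have positive arguments and the set is nonempty and bounded, so
   [ln] and the real [sup] carry no default value. *)
Definition hilbert_dist L x1 x2 : R :=
  2^-1 * sup [set ln ((polar_fun y x1 / polar_fun y x2) *
                      (polar_fun z x2 / polar_fun z x1))
             | y in polar L & z in polar L].

(* Infimum of a set that is bounded below by 0, and nonempty when C is. *)
Definition hilbert_dist_set L x C : R :=
  inf [set hilbert_dist L x c | c in C].

Definition hilbert_packing S L (alpha : R) (N : nat) : Prop :=
  exists x : 'I_N -> 'rV[R]_d,
    (forall i, S (x i)) /\
    (forall i j : 'I_N, (i < j)%N -> alpha <= hilbert_dist L (x i) (x j)).

(* Indices start at 0, so every point but the first is constrained. *)
Definition hilbert_convexified_packing S L (alpha : R) (N : nat) : Prop :=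
  exists x : 'I_N -> 'rV[R]_d,
    (forall i, S (x i)) /\
    (forall j : 'I_N, (0 < j)%N ->
       alpha <= hilbert_dist_set L (x j)
                  (convex_hull [set x i | i in [set i : 'I_N | (i < j)%N]])).

(* The largest natural number satisfying P; 0 if there is none, which does not
   happen for the two packing numbers below when S is a nonempty compact subset
   of the interior of L and alpha > 0. *)
Definition max_nat (P : nat -> Prop) : nat :=
  xget 0%N [set N | P N /\ forall n, P n -> (n <= N)%N].

Definition hilbert_packing_number S L (alpha : R) : nat :=
  max_nat (hilbert_packing S L alpha).

Definition hilbert_convexified_packing_number S L (alpha : R) : nat :=
  max_nat (hilbert_convexified_packing S L alpha).

End HilbertMetric.

(* Main.v *)
Require Import Defs.
From mathcomp Require Import all_boot all_order all_algebra.
From mathcomp Require Import all_classical all_reals all_analysis.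
From mathcomp Require Import ring lra.

Set Implicit Arguments.
Unset Strict Implicit.
Unset Printing Implicit Defensive.

Import Order.TTheory GRing.Theory Num.Theory.
Import numFieldNormedType.Exports.
Local Open Scope classical_set_scope.
Local Open Scope ring_scope.

(** The two metrics see the bodies only through the pairing
    phi(x, y) = 1 - <x, y>, which is positive on G x K°, so a packing of G in
    the metric of K can be traded for a packing of K° in the metric of G° by
    exchanging the roles of points and functionals.

    Let x_0, ..., x_(N-1) be a convexified packing of G at scale alpha.  For each
    j, the minimax argument of [hilbert_separation] replaces the distance of x_j
    to the hull of its predecessors by one pair (y_j, z_j) of points of K° that
    works for all of them: for i < j,
      ln phi(x_i, z_j) - ln phi(x_j, z_j)
        > alpha + ln phi(x_i, y_j) - ln phi(x_j, y_j).
    Put g = alpha / 8 and pigeonhole the indices j in two ways.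
    - By z_j: a maximal packing of K° at scale g is a net, so M_H(K°, G°; g)
      classes suffice for the z_j of a class to be within g of a common point
      ([hilbert_packing_net]).
    - By the height h_j = ln phi(x_j, y_j) - ln phi(x_j, z_j): placing points at
      equal logarithmic steps on a segment of K° shows that any such difference
      is smaller than 2 g times the convexified packing number of K°
      ([hilbert_convexified_packing_segment]), so a constant times that number of
      buckets of width 2 g suffices.
    Inside one class the z's and the heights are interchangeable up to 6 g, and
    for i < j there remains ln phi(x_i, y_i) - ln phi(x_i, y_j) >= 2 g.  As
    phi(x_i, .) is affine, x_i separates y_i from the hull of all later y_j: read
    backwards, the y's of a class are a convexified packing of K° at scale g
    ([hilbert_convexified_packing_of_witness]).  Hence N is at most the number of
    classes times the convexified packing number.

    Lower bounds on distances in the metric of G° always pair the chosen point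
    of G with 0, at which phi is 1; so a single logarithm, rather than a
    cross-ratio, has to be controlled. *)

(** * An alternative for finitely many concave-like functions *)

Section ConvexAlternative.
Context {R : realType} {T : Type}.
Implicit Types A : set T.

(** Ky Fan's convexity-free form of a convex domain with concave functions: the
    ratios of affine functions used below satisfy it, although they are not
    concave themselves. *)
Definition concave_like {I : Type} (A : set T) (f : I -> T -> R) :=
  forall a b t, A a -> A b -> 0 <= t <= 1 ->
    exists2 c, A c & forall i, (1 - t) * f i a + t * f i b <= f i c.

(** The image of A under (f true, f false) misses the open positive quadrant,
    so a line through the origin separates the two.  The slope is the supremum
    of the slopes forced by the points where f false is positive; the points
    where f true is positive bound it from above. *)
Lemma alternative_two (A : set T) (f : bool -> T -> R) :
  concave_like A f ->
  (forall a, A a -> f true a <= 0 \/ f false a <= 0) ->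
  exists2 m : R, 0 <= m <= 1 &
    forall a, A a -> m * f true a + (1 - m) * f false a <= 0.
Proof.
move=> fconc fle0; set p := f true; set q := f false.
have key u v : A u -> A v -> 0 < p u -> 0 < q v -> p u * q v <= q u * p v.
  move=> Au Av pu qv; rewrite leNgt; apply/negP => lt_uv.
  have qu : q u <= 0.
    by have [|//] := fle0 _ Au; rewrite -/p leNgt pu.
  have pv : p v <= 0.
    by have [//|] := fle0 _ Av; rewrite -/q leNgt qv.
  (* The weights a : b make both coordinates of the combination equal to
     positive multiples of p u * q v - q u * p v. *)
  pose a := q v - p v; pose b := p u - q u.
  have a0 : 0 < a by rewrite /a; lra.
  have b0 : 0 < b by rewrite /b; lra.
  have ab0 : 0 < a + b by rewrite addr_gt0.
  have [] := fconc u v (b / (a + b)) Au Av.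
    by rewrite divr_ge0 ?(ltW b0) ?(ltW ab0)//= ler_pdivrMr// mul1r lerDr ltW.
  move=> w Aw fw.
  have D0 : 0 < (p u * q v - q u * p v) / (a + b) by rewrite divr_gt0 ?subr_gt0.
  have E1 : (1 - b / (a + b)) * p u + b / (a + b) * p v
            = (p u * q v - q u * p v) / (a + b).
    by rewrite /a /b; field; rewrite /a /b in ab0; rewrite gt_eqF.
  have E2 : (1 - b / (a + b)) * q u + b / (a + b) * q v
            = (p u * q v - q u * p v) / (a + b).
    by rewrite /a /b; field; rewrite /a /b in ab0; rewrite gt_eqF.
  have pw := fw true; have qw := fw false.
  rewrite -/p -/q E1 in pw; rewrite -/q E2 in qw.
  have [] := fle0 _ Aw; rewrite leNgt => /negP; apply.
    exact: lt_le_trans D0 pw.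
  exact: lt_le_trans D0 qw.
have [qle0|] := pselect (forall a, A a -> q a <= 0).
  exists 0; rewrite ?lexx ?ler01// => a Aa.
  by rewrite mul0r add0r subr0 mul1r qle0.
move=> /existsNP[v /not_implyP[Av /negP]]; rewrite -ltNge => qv.
have [ple0|] := pselect (forall a, A a -> p a <= 0).
  exists 1; rewrite ?lexx ?ler01// => a Aa.
  by rewrite subrr mul0r addr0 mul1r ple0.
move=> /existsNP[u /not_implyP[Au /negP]]; rewrite -ltNge => pu.
have pneg w : A w -> 0 < q w -> p w < 0.
  move=> Aw qw; rewrite lt_neqAle; apply/andP; split; last first.
    by have [//|] := fle0 _ Aw; rewrite -/q leNgt qw.
  apply/eqP => pw; have := key u w Au Aw pu qw.
  by rewrite pw mulr0 leNgt mulr_gt0.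
pose S := [set q w / - p w | w in [set w | A w /\ 0 < q w]].
pose k := sup S.
have Sub w : A w -> 0 < p w -> ubound S (- q w / p w).
  move=> Aw pw _ [x [Ax qx] <-].
  rewrite ler_pdivrMr ?oppr_gt0 ?pneg// mulrAC ler_pdivlMr// mulrNN mulrC.
  exact: key.
have Sv : S (q v / - p v) by exists v.
have Sbnd : has_ubound S by exists (- q u / p u); apply: Sub.
have k0 : 0 <= k.
  by apply: le_trans (ub_le_sup Sbnd Sv); rewrite divr_ge0 ?ltW// oppr_gt0 pneg.
have kle w : A w -> k * p w + q w <= 0.
  move=> Aw; have [pw|pw] := ltrP 0 (p w).
    have : k <= - q w / p w.
      by apply: ge_sup; [exists (q v / - p v) | exact: Sub].
    by rewrite ler_pdivlMr//; lra.
  have [qw|qw] := ltrP 0 (q w); last first.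
    by have := mulr_ge0_le0 k0 pw; lra.
  have : q w / - p w <= k by apply: ub_le_sup => //; exists w.
  rewrite ler_pdivrMr ?oppr_gt0 ?pneg//; lra.
have k1 : 0 < k + 1 by lra.
exists (k / (k + 1)).
  by rewrite divr_ge0 ?k0 ?(ltW k1)//= ler_pdivrMr// mul1r lerDl.
move=> a Aa.
have -> : k / (k + 1) * f true a + (1 - k / (k + 1)) * f false a
          = (k * p a + q a) / (k + 1) by rewrite /p /q; field; rewrite gt_eqF.
by rewrite pmulr_lle0 ?invr_gt0// kle.
Qed.

(** A theorem of the alternative in the style of Fan, Glicksberg and Hoffman,
    which serves as a minimax theorem.  The induction
    hypothesis is applied to the part of A where the first function is positive;
    there the remaining ones have no common positivity point, and the resulting
    combination forms with the first function an instance of the case of two. *)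
Lemma concave_like_alternative (n : nat) (A : set T)
    (f : 'I_n.+1 -> T -> R) :
  concave_like A f ->
  (forall a, A a -> exists i, f i a <= 0) ->
  exists l : 'I_n.+1 -> R, [/\ forall i, 0 <= l i, \sum_i l i = 1 &
    forall a, A a -> \sum_i l i * f i a <= 0].
Proof.
elim: n A f => [|n IHn] A f fconc fle0.
  exists (fun=> 1); split; first by move=> _; exact: ler01.
    by rewrite big_ord1.
  by move=> a /fle0[i]; rewrite big_ord1 mul1r ord1.
have [|a [Aa a0]|l [l0 l1 lle0]] :=
  IHn [set a | A a /\ 0 < f ord0 a] (fun i => f (lift ord0 i)).
- move=> a b t [Aa a0] [Ab b0] t01; have [c Ac fc] := fconc a b t Aa Ab t01.
  exists c => //; split => //; apply: lt_le_trans (fc ord0).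
  have /andP[t0 t1] := t01.
  have [->|t'0] := eqVneq t 0; first by rewrite subr0 mul1r mul0r addr0.
  apply: ltr_wpDl; first by rewrite mulr_ge0 ?subr_ge0 ?(ltW a0).
  by rewrite mulr_gt0// lt_neqAle eq_sym t'0.
- have [i fi] := fle0 _ Aa; have [j|] := unliftP ord0 i.
    by move=> ij; exists j; rewrite -ij.
  by move=> i0; move: fi; rewrite i0 leNgt a0.
pose p a := \sum_i l i * f (lift ord0 i) a.
have [||m /andP[m0 m1] mle0] :=
  @alternative_two A (fun b => if b then p else f ord0).
- move=> a b t Aa Ab t01; have [c Ac fc] := fconc a b t Aa Ab t01.
  exists c => // -[]; last exact: fc.
  rewrite /p !mulr_sumr -big_split/=; apply: ler_sum => i _.
  by rewrite !(mulrCA _ (l i)) -mulrDr ler_wpM2l.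
- move=> a Aa; have [a0|a0] := ltrP 0 (f ord0 a); last by right.
  by left; apply: lle0.
exists (fun i => if unlift ord0 i is Some j then m * l j else 1 - m).
split.
- by move=> i; case: unliftP => [j _|_]; rewrite ?mulr_ge0 ?subr_ge0.
- rewrite big_ord_recl unlift_none.
  under eq_bigr do rewrite liftK.
  by rewrite -mulr_sumr l1 mulr1 subrK.
- move=> a Aa; rewrite big_ord_recl unlift_none.
  under eq_bigr do rewrite liftK -mulrA.
  by rewrite -mulr_sumr addrC; exact: mle0.
Qed.

End ConvexAlternative.

(** * The pairing between a body and its polar *)

Section PolarPairing.
Context {R : realType} {d : nat}.
Implicit Types (x y z : 'rV[R]_d) (A G K S : set 'rV[R]_d).

Lemma dotrvC (x y : 'rV[R]_d) : dotrv x y = dotrv y x.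
Proof. by apply: eq_bigr => i _; rewrite mulrC. Qed.

Lemma dotrvDr (x y z : 'rV[R]_d) :
  dotrv x (y + z) = dotrv x y + dotrv x z.
Proof.
by rewrite /dotrv -big_split; apply: eq_bigr => i _; rewrite mxE mulrDr.
Qed.

Lemma dotrvZr (a : R) (x y : 'rV[R]_d) :
  dotrv x (a *: y) = a * dotrv x y.
Proof.
by rewrite /dotrv mulr_sumr; apply: eq_bigr => i _; rewrite mxE mulrCA.
Qed.

Lemma dotrv0 (x : 'rV[R]_d) : dotrv x 0 = 0.
Proof. by rewrite -(scale0r 0) dotrvZr mul0r. Qed.

Lemma polar_funC (x y : 'rV[R]_d) :
  polar_fun x y = polar_fun y x.
Proof. by rewrite /polar_fun dotrvC. Qed.

Lemma polar_fun0 (x : 'rV[R]_d) : polar_fun 0 x = 1.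
Proof. by rewrite /polar_fun dotrvC dotrv0 subr0. Qed.

Lemma polar_fun_conv (x y z : 'rV[R]_d) (t : R) :
  polar_fun x ((1 - t) *: y + t *: z)
  = (1 - t) * polar_fun x y + t * polar_fun x z.
Proof. by rewrite /polar_fun dotrvDr !dotrvZr; ring. Qed.

Lemma polar_fun_sum (n : nat) (y : 'rV[R]_d) (l : 'I_n -> R)
    (x : 'I_n -> 'rV[R]_d) :
  \sum_i l i = 1 ->
  polar_fun y (\sum_i l i *: x i) = \sum_i l i * polar_fun y (x i).
Proof.
move=> l1.
rewrite /polar_fun.
have -> : dotrv y (\sum_i l i *: x i) = \sum_i l i * dotrv y (x i).
  elim/big_ind2 : _ => [|u a v b <- <-|i _]; first by rewrite dotrv0.
    by rewrite dotrvDr.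
  by rewrite dotrvZr.
rewrite -{1}l1 -sumrB; apply: eq_bigr => i _.
by rewrite mulrBr mulr1.
Qed.

Lemma convex_setP (A : set 'rV[R]_d) :
  convex_set A <-> (forall x y t, A x -> A y -> 0 <= t <= 1 ->
    A ((1 - t) *: x + t *: y)).
Proof.
split=> [cA x y t Ax Ay /andP[t0 t1]|cA x y t].
  have t01 : Itv.spec (@Itv.num_sem R) (Itv.Real `[0%Z, 1%Z]%O) t.
    by rewrite /Itv.spec/= /Itv.num_sem/= ger0_real// in_itv/= t0.
  have := cA y x (Itv.mk t01) (mem_set Ay) (mem_set Ax).
  by rewrite inE addrC.
rewrite !inE => Ax Ay.
have := cA y x t%:num Ay Ax; rewrite addrC; apply.
by apply/andP; split; [exact: ge0|exact: le1].
Qed.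

Lemma convex_set_sum (n : nat) (A : set 'rV[R]_d)
    (l : 'I_n -> R) (x : 'I_n -> 'rV[R]_d) :
  convex_set A -> (forall i, A (x i)) -> (forall i, 0 <= l i) ->
  \sum_i l i = 1 -> A (\sum_i l i *: x i).
Proof.
move=> /convex_setP cA.
suff H : (forall i, A (x i)) -> (forall i, 0 <= l i) -> 0 < \sum_i l i ->
    A ((\sum_i l i)^-1 *: \sum_i l i *: x i).
  by move=> Ax l0 l1; have := H Ax l0; rewrite l1 invr1 scale1r; apply.
elim: n l x => [|n IHn] l x Ax l0; first by rewrite big_ord0 ltxx.
rewrite !big_ord_recl; set s := \sum_(_ < _) _; set v := \sum_(_ < _) _ => ls0.
have s0 : 0 <= s by apply: sumr_ge0.
have [s_eq0|s_neq0] := eqVneq s 0.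
  have -> : v = 0.
    rewrite /v big1// => i _; have : l (lift ord0 i) = 0.
      by apply: (psumr_eq0P _ s_eq0).
    by move=> ->; rewrite scale0r.
  rewrite s_eq0 !addr0 scalerA mulVf ?scale1r//.
  by rewrite s_eq0 addr0 in ls0; rewrite gt_eqF.
have s_gt0 : 0 < s by rewrite lt_neqAle eq_sym s_neq0.
have -> : (l ord0 + s)^-1 *: (l ord0 *: x ord0 + v)
    = (1 - s / (l ord0 + s)) *: x ord0 + (s / (l ord0 + s)) *: (s^-1 *: v).
  rewrite scalerDr !scalerA; congr (_ *: _ + _ *: _).
    by field; rewrite gt_eqF.
  by field; rewrite !gt_eqF.
apply: cA => //; first exact: IHn.
by rewrite divr_ge0 ?(ltW ls0)//= ler_pdivrMr// mul1r lerDr.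
Qed.

Lemma polar_convex (S : set 'rV[R]_d) :
  convex_set (polar S).
Proof.
apply/convex_setP => x y t Sx Sy /andP[t0 t1] z Sz.
rewrite dotrvDr !dotrvZr; have := Sx z Sz; have := Sy z Sz => zy zx.
have u0 : 0 <= 1 - t by rewrite subr_ge0.
by have := ler_wpM2l t0 zy; have := ler_wpM2l u0 zx; lra.
Qed.

Lemma polar0 (S : set 'rV[R]_d) : polar S 0.
Proof. by move=> x _; rewrite dotrv0 ler01. Qed.

Lemma polar_polar (S : set 'rV[R]_d) :
  S `<=` polar (polar S).
Proof. by move=> x Sx y /(_ x Sx); rewrite dotrvC. Qed.

Lemma compact_coord_bounded (G : set 'rV[R]_d) :
  compact G -> exists2 B : R, 0 < B &
    forall (x : 'rV[R]_d) i, G x -> `|x ord0 i| <= B.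
Proof.
move=> /compact_bounded[M [_ GM]]; exists (`|M| + 1); first by rewrite ltr_wpDl.
move=> x i Gx; have xM : `|x| <= `|M| + 1.
  by apply: GM => //; rewrite (le_lt_trans (ler_norm M))// ltrDl.
apply: le_trans xM; rewrite [leRHS]/Num.Def.normr/= mx_normrE.
by rewrite (le_bigmax _ (fun ij : 'I_1 * 'I_d => `|x ij.1 ij.2|) (ord0, i)).
Qed.

Lemma interior0_cube (G : set 'rV[R]_d) :
  G° 0 -> exists2 r : R, 0 < r &
    forall v : 'rV[R]_d, (forall i, `|v ord0 i| <= r) -> G v.
Proof.
move=> /nbhs_ballP[e /= e0 eG]; exists (e / 2); first by rewrite divr_gt0.
move=> v vr; apply: eG; split=> // i j; rewrite ord1 !mxE /ball/= sub0r normrN.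
by apply: le_lt_trans (vr j) _; rewrite ltr_pdivrMr// ltr_pMr// ltr1n.
Qed.

(** Each point of G has a neighbourhood whose small dilates stay in K;
    compactness makes the dilation factor uniform. *)
Lemma compact_interior_dilation (G K : set 'rV[R]_d) :
  compact G -> G `<=` K° ->
  exists2 e : R, 0 < e & forall x, G x -> K ((1 + e) *: x).
Proof.
move=> /compact_near_coveringP cG GK.
have : \forall e \near (0 : R), G `<=` (fun x => K ((1 + e) *: x)).
  apply: (cG R (nbhs (0 : R)) (fun e x => K ((1 + e) *: x))) => x /GK Kx.
  have cvgx : (fun p : 'rV[R]_d * R => (1 + p.2) *: p.1) @ (x, 0) --> x.
    suff : (fun p : 'rV[R]_d * R => (1 + p.2) *: p.1) @ (x, 0) --> (1 + 0) *: x.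
      by rewrite addr0 scale1r.
    apply: cvgZ; last exact: cvg_fst.
    by apply: cvgD; [exact: cvg_cst|exact: cvg_snd].
  exact: cvgx Kx.
move=> /nbhs_ballP[e /= e0 eK]; exists (e / 2); first by rewrite divr_gt0.
move=> x Gx; apply: eK => //; rewrite /ball/= sub0r normrN.
rewrite gtr0_norm ?divr_gt0//.
by rewrite ltr_pdivrMr// ltr_pMr// ltr1n.
Qed.

Lemma polar_coord_bounded (K : set 'rV[R]_d) :
  K° 0 -> exists2 B : R, 0 < B &
    forall (y : 'rV[R]_d) i, polar K y -> `|y ord0 i| <= B.
Proof.
move=> /interior0_cube[r r0 Kr]; exists r^-1; first by rewrite invr_gt0.
move=> y i Ky.
have H (a : R) : `|a| <= r -> a * y ord0 i <= 1.
  move=> ar; have := Ky (\row_j (a *+ (j == i))).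
  have -> : dotrv (\row_j (a *+ (j == i))) y = a * y ord0 i.
    rewrite /dotrv (bigD1 i)//= mxE eqxx mulr1n big1 ?addr0// => j /negbTE ji.
    by rewrite mxE ji mul0r.
  apply; apply: Kr => j; rewrite mxE; case: eqP => _; rewrite ?mulr1n//.
  by rewrite mulr0n normr0 ltW.
have H1 := H r; have H2 := H (- r); rewrite ?normrN gtr0_norm// lexx in H1 H2.
rewrite -[leRHS]mul1r ler_pdivlMr//.
by case: (ger0P (y ord0 i)) => _; lra.
Qed.

End PolarPairing.

(** * The Hilbert metric of the polar of G on the polar of K *)

Section HilbertPolar.
Context {R : realType} {d : nat}.
Implicit Types (x y z : 'rV[R]_d) (L S : set 'rV[R]_d).

(** Taking 0 for both functionals contributes ln 1 to the supremum; and the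
    real supremum of a set without upper bound is 0. *)
Lemma hilbert_dist_ge0 L y z : 0 <= hilbert_dist L y z.
Proof.
rewrite /hilbert_dist mulr_ge0// ?invr_ge0//.
set E := [set _ | _ in _ & _ in _].
have [[_ Eub]|/sup_out ->//] := pselect (has_sup E).
apply: (ub_le_sup Eub); exists 0; first exact: polar0.
exists 0; first exact: polar0.
by rewrite !polar_fun0 divr1 mulr1 ln1.
Qed.

Lemma hilbert_dist_set_le L C x c : C c ->
  hilbert_dist_set L x C <= hilbert_dist L x c.
Proof.
move=> Cc; apply: ge_inf; last by exists c.
by exists 0 => _ [y _ <-]; exact: hilbert_dist_ge0.
Qed.

Context {G K : set 'rV[R]_d}.
Hypotheses (Gcompact : compact G) (G0 : G° 0) (GK : G `<=` K°).

Let K0 : K° 0.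
Proof. exact: GK (interior_subset G0). Qed.

(** Since (1 + e) G is still inside K, the dilate (1 + e) K° is inside G°;
    this keeps the pairing away from 0 on the whole bipolar of G, which is the
    set that the metric of G° ranges over. *)
Lemma pairing_bounded_below : exists2 e : R, 0 < e &
  forall x y, polar (polar G) x -> polar K y -> e <= polar_fun x y.
Proof.
have [e e0 eK] := compact_interior_dilation Gcompact GK.
have e1 : 0 < 1 + e by rewrite addr_gt0.
exists (e / (1 + e)) => [|x y Gx Ky]; first by rewrite divr_gt0.
have : dotrv x ((1 + e) *: y) <= 1.
  rewrite dotrvC; apply: Gx => z Gz.
  have -> : dotrv z ((1 + e) *: y) = dotrv ((1 + e) *: z) y.
    by rewrite dotrvZr (dotrvC z) -dotrvZr; exact: dotrvC.
  by apply: Ky; exact: eK.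
rewrite dotrvZr mulrC -ler_pdivlMr// /polar_fun => xy.
have -> : e / (1 + e) = 1 - 1 / (1 + e) by field; rewrite gt_eqF.
by rewrite lerD2l lerN2.
Qed.

Lemma pairing_gt0 x y : polar (polar G) x -> polar K y -> 0 < polar_fun x y.
Proof.
have [e e0 H] := pairing_bounded_below.
by move=> Gx Ky; apply: lt_le_trans e0 (H _ _ Gx Ky).
Qed.

(** The boundedness of G puts a cube around 0 in G°, so the numerator is
    Lipschitz in y, while the denominator is bounded below. *)
Lemma pairing_lipschitz : exists2 l : R, 0 < l &
  forall x y z s, polar (polar G) x -> polar K y -> polar K z -> 0 < s ->
    (forall i, `|y ord0 i - z ord0 i| <= s) ->
    polar_fun x y / polar_fun x z <= 1 + l * s.
Proof.
have [e e0 He] := pairing_bounded_below.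
have [B B0 GB] := compact_coord_bounded Gcompact.
pose D := d.+1%:R * B; have D0 : 0 < D by rewrite mulr_gt0.
exists (D / e) => [|x y z s Gx Ky Kz s0 yzs]; first by rewrite divr_gt0.
have Ds0 : 0 < D * s by rewrite mulr_gt0.
have : dotrv x ((D * s)^-1 *: (z - y)) <= 1.
  rewrite dotrvC; apply: Gx => u Gu; rewrite dotrvZr mulrC ler_pdivrMr// mul1r.
  apply: (@le_trans _ _ (\sum_(i < d) B * s)).
    apply: ler_sum => i _; apply: le_trans (ler_norm _) _.
    by rewrite normrM ler_pM// ?GB// !mxE distrC yzs.
  rewrite sumr_const card_ord -mulr_natl /D -mulrA ler_wpM2r//.
    by rewrite mulr_ge0// ltW.
  by rewrite ler_nat.
rewrite dotrvZr mulrC ler_pdivrMr// mul1r => xyz.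
have xz := He _ _ Gx Kz; have xz0 := lt_le_trans e0 xz.
rewrite ler_pdivrMr// mulrDl mul1r.
have -> : polar_fun x y = polar_fun x z + dotrv x (z - y).
  by rewrite /polar_fun dotrvDr -(scaleN1r y) dotrvZr; ring.
rewrite lerD2l (le_trans xyz)//.
have -> : D / e * s * polar_fun x z = D * s * (polar_fun x z / e).
  by field; rewrite gt_eqF.
by rewrite ler_peMr ?(ltW Ds0)// ler_pdivlMr// mul1r.
Qed.

(** Stated for the set of logarithms rather than for its supremum: it yields
    both the finiteness of the distance and the comparison with the sup norm. *)
Lemma hilbert_dist_polar_lipschitz : exists2 l : R, 0 < l &
  forall y z s, polar K y -> polar K z -> 0 < s ->
    (forall i, `|y ord0 i - z ord0 i| <= s) ->
    ubound [set ln ((polar_fun u y / polar_fun u z) *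
                    (polar_fun v z / polar_fun v y))
           | u in polar (polar G) & v in polar (polar G)] (2 * (l * s)).
Proof.
have [l l0 Hl] := pairing_lipschitz.
exists l => // y z s Ky Kz s0 yzs _ [u Gu [v Gv <-]].
have pos x1 x2 x3 : polar (polar G) x1 -> polar K x2 -> polar K x3 ->
    polar_fun x1 x2 / polar_fun x1 x3 \is Num.pos.
  by move=> *; rewrite posrE divr_gt0// pairing_gt0.
have Hle x1 x2 x3 : polar (polar G) x1 -> polar K x2 -> polar K x3 ->
    (forall i, `|x2 ord0 i - x3 ord0 i| <= s) ->
    ln (polar_fun x1 x2 / polar_fun x1 x3) <= l * s.
  move=> G1 K2 K3 x23; apply: (@le_trans _ _ (ln (1 + l * s))).
    rewrite ler_ln ?pos//; first exact: Hl.
    by rewrite posrE addr_gt0// mulr_gt0.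
  by apply: le_ln1Dx; apply: lt_trans (mulr_gt0 l0 s0); rewrite ltrN10.
rewrite lnM ?pos// mulr_natl mulr2n lerD// Hle// => i.
by rewrite distrC.
Qed.

(** The cross-ratio of x and 0, where 0 contributes a factor 1. *)
Lemma ln_pairing_le_hilbert_dist x y z : G x -> polar K y -> polar K z ->
  `|ln (polar_fun x y) - ln (polar_fun x z)| <= 2 * hilbert_dist (polar G) y z.
Proof.
move=> /polar_polar Gx Ky Kz; rewrite /hilbert_dist mulrA mulfV ?mul1r//.
set E := [set _ | _ in _ & _ in _].
have Eub : has_ubound E.
  have [l l0 Hl] := hilbert_dist_polar_lipschitz.
  have [B B0 KB] := polar_coord_bounded K0.
  exists (2 * (l * (B + B))); apply: Hl; rewrite ?addr_gt0// => i.
  by apply: le_trans (ler_normB _ _) _; apply: lerD; exact: KB.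
have pos u : polar K u -> polar_fun x u \is Num.pos.
  by move=> Ku; rewrite posrE pairing_gt0.
have lnB u v : polar K u -> polar K v ->
    ln (polar_fun x u) - ln (polar_fun x v)
    = ln (polar_fun x u / polar_fun x v).
  by move=> Ku Kv; rewrite lnM ?posrE ?invr_gt0 -?posrE ?pos// lnV ?pos.
rewrite ler_norml lerNl opprB !lnB//; apply/andP.
split; apply: (ub_le_sup Eub).
  exists 0; first exact: polar0.
  by exists x => //; rewrite !polar_fun0 divr1 mul1r.
exists x => //; exists 0; first exact: polar0.
by rewrite !polar_fun0 divr1 mulr1.
Qed.

(** * Packings of the polar of K *)

(** By the Lipschitz bound, two points in the same cell of a fine enough grid
    are too close to belong to the same packing, and K° meets only finitely many
    cells. *)
Lemma hilbert_packing_bounded (g : R) : 0 < g ->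
  exists B, forall n, hilbert_packing (polar K) (polar G) g n -> (n <= B)%N.
Proof.
move=> g0.
have [l l0 Hl] := hilbert_dist_polar_lipschitz.
have [B B0 KB] := polar_coord_bounded K0.
pose s := g / (2 * l); have s0 : 0 < s by rewrite divr_gt0// mulr_gt0.
pose m := Num.truncn (2 * B / s).
pose cell y : {ffun 'I_d -> 'I_m.+1} :=
  [ffun i => inord (Num.truncn ((y ord0 i + B) / s))].
exists #|{ffun 'I_d -> 'I_m.+1}| => n [y [Ky ysep]].
have cell_close u v : polar K u -> polar K v -> cell u = cell v ->
    forall i, `|u ord0 i - v ord0 i| <= s.
  move=> Ku Kv uv i.
  have bnd w : polar K w -> 0 <= (w ord0 i + B) / s <= 2 * B / s.
    move=> /(KB _ i); rewrite ler_norml => /andP[w1 w2].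
    by rewrite divr_ge0 ?(ltW s0)//= ?ler_pM2r ?invr_gt0//; lra.
  have tr w : polar K w -> (Num.truncn ((w ord0 i + B) / s) < m.+1)%N.
    by move=> /bnd/andP[_ wB]; rewrite ltnS /m le_truncn.
  have : Num.truncn ((u ord0 i + B) / s) = Num.truncn ((v ord0 i + B) / s).
    rewrite -(inordK (tr _ Ku)) -(inordK (tr _ Kv)).
    by move/ffunP/(_ i): uv; rewrite !ffunE => ->.
  have /andP[/truncn_itv/andP[u1 u2] _] := bnd u Ku.
  have /andP[/truncn_itv/andP[v1 v2] _] := bnd v Kv.
  move=> uvE; rewrite uvE in u1 u2.
  rewrite ler_pdivlMr// in u1; rewrite ltr_pdivrMr// in u2.
  rewrite ler_pdivlMr// in v1; rewrite ltr_pdivrMr// in v2.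
  rewrite -natr1 mulrDl mul1r in u2; rewrite -natr1 mulrDl mul1r in v2.
  by rewrite ler_norml; apply/andP; split; lra.
have sep (i j : 'I_n) : (i < j)%N -> cell (y i) <> cell (y j).
  move=> ij cij; have := ysep i j ij; rewrite leNgt => /negP; apply.
  apply: (@le_lt_trans _ _ (l * s)); last first.
    have -> : l * s = g / 2 by rewrite /s; field; rewrite gt_eqF.
    lra.
  rewrite /hilbert_dist mulrC ler_pdivrMr// mulrC.
  apply: ge_sup; last by apply: Hl => //; exact: cell_close.
  by eexists; exists 0; [exact: polar0|exists 0; [exact: polar0|reflexivity]].
rewrite -[n in (n <= _)%N]card_ord.
apply: (@leq_card _ _ (cell \o y)) => i j /= cij.
apply: val_inj; case: (ltngtP i j) => // lt_ij; first by have := sep _ _ lt_ij.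
by have := sep _ _ lt_ij; rewrite cij.
Qed.

(** The predecessors of y_j lie in the sublevel set of the affine function
    [polar_fun x], hence so does their hull. *)
Lemma hilbert_convexified_packing_of_witness (g : R) (n : nat)
    (y : 'I_n -> 'rV[R]_d) :
  (forall i, polar K (y i)) ->
  (forall j : 'I_n, exists2 x, G x & forall i : 'I_n, (i < j)%N ->
    2 * g <= ln (polar_fun x (y j)) - ln (polar_fun x (y i))) ->
  hilbert_convexified_packing (polar K) (polar G) g n.
Proof.
move=> Ky wit; exists y; split=> // j j0.
have n0 : (0 < n)%N := leq_ltn_trans (leq0n j) (ltn_ord j).
have [x Gx xy] := wit j.
apply: lb_le_inf.
  exists (hilbert_dist (polar G) (y j) (y (Ordinal n0))).
  exists (y (Ordinal n0)) => //.
  by move=> M [_]; apply; exists (Ordinal n0).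
move=> _ [c hull_c <-].
have Gx' := polar_polar Gx.
have [Kc xc] : polar K c /\
    polar_fun x c <= expR (- (2 * g)) * polar_fun x (y j).
  apply: (smallest_sub (X := [set c | polar K c /\
    polar_fun x c <= expR (- (2 * g)) * polar_fun x (y j)])) hull_c.
    apply/convex_setP => u v t [Ku xu] [Kv xv] t01.
    split; first by have /convex_setP := @polar_convex R d K; apply.
    rewrite polar_fun_conv; have /andP[t0 t1] := t01.
    have t1' : 0 <= 1 - t by rewrite subr_ge0.
    by have := ler_wpM2l t1' xu; have := ler_wpM2l t0 xv; lra.
  move=> _ [i /= ij <-]; split=> //.
  have xij := xy i ij.
  rewrite -ler_ln ?posrE ?mulr_gt0 ?expR_gt0 ?pairing_gt0//.
  rewrite lnM ?posrE ?expR_gt0 ?pairing_gt0// expRK; lra.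
have := ln_pairing_le_hilbert_dist Gx (Ky j) Kc; apply: contraTT.
rewrite -!ltNge => lt_g.
apply: lt_le_trans (ler_norm _).
have : ln (polar_fun x c) <= - (2 * g) + ln (polar_fun x (y j)).
  rewrite -(expRK (- (2 * g))) -lnM ?posrE ?expR_gt0 ?pairing_gt0//.
  by rewrite ler_ln ?posrE ?mulr_gt0 ?expR_gt0 ?pairing_gt0.
lra.
Qed.

(** Along the segment from y to z the affine function [polar_fun x] takes every
    intermediate value; the points where its logarithm has grown by multiples of
    2 g are witnessed by x itself. *)
Lemma hilbert_convexified_packing_segment (g : R) x y z :
  0 < g -> G x -> polar K y -> polar K z ->
  ln (polar_fun x y) <= ln (polar_fun x z) ->
  hilbert_convexified_packing (polar K) (polar G) g
    (Num.truncn ((ln (polar_fun x z) - ln (polar_fun x y)) / (2 * g))).+1.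
Proof.
move=> g0 Gx Ky Kz yz; set n := Num.truncn _.
have Gx' := polar_polar Gx.
have g20 : 0 < 2 * g by rewrite mulr_gt0.
pose a := polar_fun x y; pose b := polar_fun x z.
have a0 : 0 < a by rewrite pairing_gt0.
have b0 : 0 < b by rewrite pairing_gt0.
have ab : a <= b by rewrite -ler_ln ?posrE.
have nle : n%:R * (2 * g) <= ln b - ln a.
  by rewrite -ler_pdivlMr// truncn_le divr_ge0 ?(ltW g20)// subr_ge0.
have /choice[w Hw] : forall k : 'I_n.+1, exists w, polar K w /\
    ln (polar_fun x w) = ln a + k%:R * (2 * g).
  move=> k.
  pose v := a * expR (k%:R * (2 * g)).
  have lnv : ln v = ln a + k%:R * (2 * g).
    by rewrite lnM ?posrE ?expR_gt0// expRK.
  have v0 : 0 < v by rewrite mulr_gt0 ?expR_gt0.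
  have av : a <= v.
    by rewrite -ler_ln ?posrE// lnv lerDl mulr_ge0// ltW.
  have vb : v <= b.
    rewrite -ler_ln ?posrE// lnv -lerBrDl (le_trans _ nle)//.
    by rewrite ler_wpM2r ?(ltW g20)// ler_nat -ltnS.
  have [eq_ab|lt_ab] := eqVneq a b.
    exists y; split=> //; rewrite -lnv; congr ln; apply/eqP.
    by rewrite eq_le -/a av eq_ab.
  have ba0 : 0 < b - a by rewrite subr_gt0 lt_neqAle lt_ab.
  exists ((1 - (v - a) / (b - a)) *: y + ((v - a) / (b - a)) *: z); split.
    have /convex_setP := @polar_convex R d K; apply=> //.
    by rewrite divr_ge0 ?subr_ge0 ?(ltW ba0)//= ler_pdivrMr// mul1r lerB.
  rewrite -lnv polar_fun_conv -/a -/b; congr ln; field.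
  by rewrite gt_eqF.
apply: (@hilbert_convexified_packing_of_witness _ _ w) => [k|k].
  by have [] := Hw k.
exists x => // i ik; have [_ ->] := Hw k; have [_ ->] := Hw i.
rewrite opprD addrACA subrr add0r -mulrBl ler_peMl ?(ltW g20)//.
by rewrite lerBrDl natr1 ler_nat.
Qed.

(** * Dual functionals of a separated point *)

(** The central projection from the cone over K° onto the slice where
    [polar_fun w] equals 1 is a projective map, and its image is convex. *)
Lemma polar_pairing_ratio_conv w y z (t : R) :
  G w -> polar K y -> polar K z -> 0 <= t <= 1 ->
  exists2 u, polar K u & forall x,
    polar_fun x u / polar_fun w u =
      (1 - t) * (polar_fun x y / polar_fun w y)
      + t * (polar_fun x z / polar_fun w z).
Proof.
move=> /polar_polar Gw Ky Kz /andP[t0 t1].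
(* The weight t * p / D is the one that t becomes under the projective map. *)
pose p := polar_fun w y; pose q := polar_fun w z.
have p0 : 0 < p by rewrite pairing_gt0.
have q0 : 0 < q by rewrite pairing_gt0.
pose D := (1 - t) * q + t * p.
have D0 : 0 < D.
  rewrite /D; have [->|t_neq0] := eqVneq t 0.
    by rewrite subr0 mul1r mul0r addr0.
  apply: ltr_wpDl; first by rewrite mulr_ge0 ?(ltW q0) ?subr_ge0.
  by rewrite mulr_gt0// lt_neqAle eq_sym t_neq0.
exists ((1 - t * p / D) *: y + (t * p / D) *: z).
  have /convex_setP := @polar_convex R d K; apply=> //.
  rewrite divr_ge0 ?mulr_ge0 ?(ltW p0) ?(ltW D0)//= ler_pdivrMr// mul1r /D.
  by rewrite lerDr mulr_ge0 ?(ltW q0) ?subr_ge0.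
move=> x; rewrite !polar_fun_conv -/p -/q /D; rewrite /D in D0.
by field; rewrite !gt_eqF//=; nra.
Qed.

(** The minimax step.  If no pair (y, z) worked for all x_i at once, then by the
    alternative some convex combination of the functions
    phi(x_i, z) / phi(w, z) - e^a phi(x_i, y) / phi(w, y) would be nonpositive on
    K° x K°.  Affinity of phi in the first argument turns that combination into
    the same expression at the point c of C with these weights, and then c is at
    distance at most a / 2 from w.  The factor 2 between a / 2 and a pays for the
    strict inequalities of the conclusion. *)
Lemma hilbert_separation (n : nat) (x : 'I_n.+1 -> 'rV[R]_d) (C : set 'rV[R]_d)
    w (a : R) :
  0 < a -> G w -> convex_set C -> C `<=` G -> (forall i, C (x i)) ->
  a <= hilbert_dist_set K w C ->
  exists y z, [/\ polar K y, polar K z & forall i,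
    a + ln (polar_fun (x i) y) - ln (polar_fun w y) <
    ln (polar_fun (x i) z) - ln (polar_fun w z)].
Proof.
move=> a0 Gw Cconv CG Cx distC; apply: contrapT => nosep.
pose A := [set yz | polar K yz.1 /\ polar K yz.2].
pose f i (yz : 'rV[R]_d * 'rV[R]_d) :=
  polar_fun (x i) yz.2 / polar_fun w yz.2
  - expR a * (polar_fun (x i) yz.1 / polar_fun w yz.1).
have pos u y : G u -> polar K y -> polar_fun u y \is Num.pos.
  by move=> /polar_polar Gu Ky; rewrite posrE pairing_gt0.
have lnB u v y : G u -> G v -> polar K y ->
    ln (polar_fun u y / polar_fun v y)
    = ln (polar_fun u y) - ln (polar_fun v y).
  by move=> Gu Gv Ky; rewrite lnM ?posrE ?invr_gt0 -?posrE ?pos// lnV ?pos.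
have [||l [l0 l1 lf]] := @concave_like_alternative _ _ n A f.
- move=> [y z] [y' z'] t [/= Ky Kz] [/= Ky' Kz'] t01.
  have [u Ku uE] := polar_pairing_ratio_conv Gw Ky Ky' t01.
  have [v Kv vE] := polar_pairing_ratio_conv Gw Kz Kz' t01.
  by exists (u, v) => // i; rewrite /f/= uE vE; lra.
- move=> [y z] [/= Ky Kz]; apply: contrapT => /forallNP fpos.
  apply: nosep; exists y, z; split=> // i.
  have /negP := fpos i; rewrite -ltNge /f/= subr_gt0.
  have Gx := CG _ (Cx i).
  rewrite -ltr_ln ?posrE ?mulr_gt0 ?invr_gt0 ?expR_gt0 -?posrE ?pos//.
  rewrite lnM ?posrE ?mulr_gt0 ?invr_gt0 ?expR_gt0 -?posrE ?pos//.
  by rewrite expRK !lnB// addrA.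
pose c := \sum_i l i *: x i.
have Cc : C c by apply: convex_set_sum.
have Gc := CG _ Cc.
have cE y : polar_fun c y = \sum_i l i * polar_fun (x i) y.
  rewrite polar_funC polar_fun_sum//; apply: eq_bigr => i _.
  by rewrite polar_funC.
have : hilbert_dist K w c <= 2^-1 * a.
  rewrite /hilbert_dist ler_wpM2l ?invr_ge0//; apply: ge_sup.
    by eexists; exists 0; [exact: polar0|exists 0; [exact: polar0|reflexivity]].
  move=> _ [y Ky [z Kz <-]].
  have := lf (y, z) (conj Ky Kz).
  have -> : \sum_i l i * f i (y, z) = polar_fun c z / polar_fun w z
      - expR a * (polar_fun c y / polar_fun w y).
    rewrite !cE !mulr_suml mulr_sumr -sumrB; apply: eq_bigr => i _.
    by rewrite /f/=; ring.
  rewrite subr_le0.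
  rewrite -ler_ln ?posrE ?mulr_gt0 ?invr_gt0 ?expR_gt0 -?posrE ?pos//.
  rewrite (@lnM _ (expR a)) ?posrE ?mulr_gt0 ?invr_gt0 ?expR_gt0 -?posrE ?pos//.
  rewrite expRK !lnB// !(polar_funC y) !(polar_funC z).
  rewrite lnM ?posrE ?mulr_gt0 ?invr_gt0 ?expR_gt0 -?posrE ?pos//.
  by rewrite !lnB//; lra.
have := hilbert_dist_set_le K w Cc.
lra.
Qed.

Lemma convexified_packing_dual_pairs (a : R) (n : nat) (x : 'I_n -> 'rV[R]_d) :
  0 < a -> convex_set G -> (forall i, G (x i)) ->
  (forall j : 'I_n, (0 < j)%N -> a <= hilbert_dist_set K (x j)
     (convex_hull [set x i | i in [set i : 'I_n | (i < j)%N]])) ->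
  exists y z : 'I_n -> 'rV[R]_d, forall j, [/\ polar K (y j), polar K (z j) &
    forall i : 'I_n, (i < j)%N ->
      a + ln (polar_fun (x i) (y j)) - ln (polar_fun (x j) (y j)) <
      ln (polar_fun (x i) (z j)) - ln (polar_fun (x j) (z j))].
Proof.
move=> a0 Gconv Gx xsep.
suff /choice[yz Hyz] : forall j : 'I_n, exists yz : 'rV[R]_d * 'rV[R]_d,
    [/\ polar K yz.1, polar K yz.2 & forall i : 'I_n, (i < j)%N ->
      a + ln (polar_fun (x i) yz.1) - ln (polar_fun (x j) yz.1) <
      ln (polar_fun (x i) yz.2) - ln (polar_fun (x j) yz.2)].
  by exists (fun j => (yz j).1), (fun j => (yz j).2).
move=> j; have [j0|j0] := posnP j.
  (* The first point has no predecessor to be separated from. *)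
  by exists (0, 0); split=> [||i]; [exact: polar0|exact: polar0|rewrite j0].
set C := convex_hull [set x i | i in [set i : 'I_n | (i < j)%N]].
have CG : C `<=` G by apply: smallest_sub => // _ [i _ <-].
have Cconv : convex_set C.
  apply/convex_setP => u v t Cu Cv t01 M [Mconv Mx].
  by apply: (proj1 (convex_setP M) Mconv) => //; [exact: Cu|exact: Cv].
have sub (i : 'I_j.-1.+1) : (i < j)%N by rewrite -[X in (_ < X)%N](prednK j0).
(* Every i < j is also below n, so the default value j is never taken. *)
pose x' (i : 'I_j.-1.+1) := x (insubd j i : 'I_n).
have Cx' i : C (x' i).
  move=> M [_]; apply; exists (insubd j i : 'I_n) => //=.
  by rewrite val_insubd (ltn_trans (sub i) (ltn_ord j)).
have [y [z [Ky Kz yz]]] :=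
  hilbert_separation a0 (Gx j) Cconv CG Cx' (xsep j j0).
exists (y, z); split=> // i ij /=.
have ij' : (i < j.-1.+1)%N by rewrite prednK.
have := yz (Ordinal ij').
by have -> : x' (Ordinal ij') = x i by rewrite /x'/= valKd.
Qed.

(** A point far from all centres could be added to the packing. *)
Lemma hilbert_packing_net (g : R) (m : nat) :
  hilbert_packing (polar K) (polar G) g m ->
  ~ hilbert_packing (polar K) (polar G) g m.+1 ->
  exists2 w : 'I_m -> 'rV[R]_d, forall k, polar K (w k) &
    forall z, polar K z -> exists k, hilbert_dist (polar G) (w k) z < g.
Proof.
move=> [w [Kw wsep]] maxm; exists w => // z Kz.
apply: contrapT => /forallNP far; apply: maxm.
exists (fun i : 'I_m.+1 => if unlift ord_max i is Some k then w k else z).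
split=> [i|i j]; first by case: unliftP.
case: (unliftP ord_max i) => [k ->|->]; last first.
  by rewrite ltnNge -ltnS ltn_ord.
case: (unliftP ord_max j) => [k' ->|_ _].
  by rewrite !lift_max; exact: wsep.
by have /negP := far k; rewrite -leNgt.
Qed.

End HilbertPolar.

(** * Comparison of the packing numbers *)

Section PackingNumbers.
Context {R : realType} {d : nat}.
Implicit Types (x y z : 'rV[R]_d) (G K L S : set 'rV[R]_d).

Lemma max_nat_spec (P : nat -> Prop) (B : nat) :
  P 0%N -> (forall n, P n -> (n <= B)%N) ->
  P (max_nat P) /\ forall n, P n -> (n <= max_nat P)%N.
Proof.
move=> P0 PB.
apply: (@xgetPex _ 0%N [set N | P N /\ forall n, P n -> (n <= N)%N]).
have exP : exists n, `[< P n >] by exists 0%N; apply/asboolP.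
have [|N /asboolP PN Nmax] := @ex_maxnP (fun n => `[< P n >]) B exP.
  by move=> n /asboolP; exact: PB.
by exists N; split=> // n Pn; apply: Nmax; apply/asboolP.
Qed.

Lemma max_nat_eq0_or (P : nat -> Prop) : max_nat P = 0%N \/ P (max_nat P).
Proof. by rewrite /max_nat; case: xgetP => [n _ []|_]; [right|left]. Qed.

Lemma hilbert_packing0 S L (g : R) : hilbert_packing S L g 0.
Proof. by exists (fun=> 0); split=> -[]. Qed.

Lemma hilbert_convexified_packing0 S L (g : R) :
  hilbert_convexified_packing S L g 0.
Proof. by exists (fun=> 0); split=> -[]. Qed.

(** The order is reversed because a convexified packing measures distances from
    the later point, a packing from the earlier one. *)
Lemma hilbert_convexified_packing_sub S L (g : R) n :
  hilbert_convexified_packing S L g n -> hilbert_packing S L g n.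
Proof.
move=> [x [Sx xsep]]; exists (x \o @rev_ord n).
split=> [i|i j ij]; first exact: Sx.
have ji : (rev_ord j < rev_ord i)%N.
  by rewrite /= ltn_sub2l// (leq_ltn_trans _ (ltn_ord j)).
apply: le_trans (xsep (rev_ord i) (leq_ltn_trans (leq0n _) ji)) _.
apply: hilbert_dist_set_le => M [_]; apply.
by exists (rev_ord j).
Qed.

(** The double pigeonhole described at the top.  The scale 8^-1 * a is chosen
    so that 2 g remains of a = 8 g after three errors of size 2 g: one for the
    heights and two for the distances of z_i and z_j to their common centre. *)
Lemma hilbert_convexified_packing_duality G K (a : R) (N M Mh : nat) :
  compact G -> convex_set G -> G° 0 -> G `<=` K° -> 0 < a ->
  hilbert_convexified_packing G K a N ->
  hilbert_packing (polar K) (polar G) (8^-1 * a) M ->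
  ~ hilbert_packing (polar K) (polar G) (8^-1 * a) M.+1 ->
  (forall n, hilbert_convexified_packing (polar K) (polar G) (8^-1 * a) n ->
    (n <= Mh)%N) ->
  (N <= 3 * Mh ^ 2 * M)%N.
Proof.
move=> Gcompact Gconvex G0 GK a0 [x [Gx xsep]] packM maxM maxMh.
set g := 8^-1 * a in packM maxM maxMh.
have g0 : 0 < g by rewrite mulr_gt0.
have ag : a = 8 * g by rewrite /g; field.
have [y [z yz]] :=
  convexified_packing_dual_pairs Gcompact GK a0 Gconvex Gx xsep.
have Ky j : polar K (y j) by have [] := yz j.
have Kz j : polar K (z j) by have [] := yz j.
have [w Kw wnet] := hilbert_packing_net packM maxM.
have /choice[k Hk] : forall j, exists k, hilbert_dist (polar G) (w k) (z j) < g.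
  by move=> j; exact: wnet.
pose H j := ln (polar_fun (x j) (y j)) - ln (polar_fun (x j) (z j)).
have segment u v v' : G u -> polar K v -> polar K v' ->
    ln (polar_fun u v') - ln (polar_fun u v) < Mh%:R * (2 * g).
  move=> Gu Kv Kv'; rewrite -ltr_pdivrMr ?mulr_gt0//.
  have [le_vv'|lt_v'v] := lerP (ln (polar_fun u v)) (ln (polar_fun u v')).
    have /maxMh leMh := hilbert_convexified_packing_segment
      Gcompact G0 GK g0 Gu Kv Kv' le_vv'.
    by apply: lt_le_trans (truncnS_gt _) _; rewrite ler_nat.
  apply: lt_le_trans (ler0n _ _).
  by rewrite pmulr_llt0 ?subr_lt0// invr_gt0 mulr_gt0.
have Mh0 : (0 < Mh)%N.
  have := segment 0 0 0 (interior_subset G0) (@polar0 R d K) (@polar0 R d K).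
  by rewrite subrr pmulr_lgt0 ?ltr0n// mulr_gt0.
pose t j := (H j + Mh%:R * (2 * g)) / (2 * g).
have t0 j : 0 <= t j.
  apply: divr_ge0; last by rewrite mulr_ge0// ltW.
  by have := segment _ _ _ (Gx j) (Ky j) (Kz j); rewrite /H; lra.
have tMh j : (Num.truncn (t j) < (2 * Mh).+1)%N.
  rewrite ltnS -(ler_nat R); apply: le_trans (_ : t j <= _).
    by rewrite truncn_le.
  rewrite ler_pdivrMr ?mulr_gt0// natrM.
  by have := segment _ _ _ (Gx j) (Kz j) (Ky j); rewrite /H; lra.
pose cls j := (k j, inord (Num.truncn (t j)) : 'I_(2 * Mh).+1).
have cls_close i j : cls i = cls j -> k i = k j /\ H j - H i < 2 * g.
  move=> [kij tij]; split=> //.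
  have {}tij : Num.truncn (t i) = Num.truncn (t j).
    by rewrite -(inordK (tMh i)) -(inordK (tMh j)) tij.
  have /andP[i1 _] := truncn_itv (t0 i); have /andP[_ j2] := truncn_itv (t0 j).
  rewrite tij in i1.
  have : t j - t i < 1 by rewrite -natr1 in j2; lra.
  by rewrite /t -mulrBl ltr_pdivrMr ?mulr_gt0// mul1r; lra.
have key (i j : 'I_N) : (i < j)%N -> cls i = cls j ->
    2 * g <= ln (polar_fun (x i) (y i)) - ln (polar_fun (x i) (y j)).
  move=> ij /cls_close[kij Hij]; have [_ _ /(_ i ij) sep] := yz j.
  have near l : hilbert_dist (polar G) (w (k i)) (z l) < g ->
      `|ln (polar_fun (x i) (w (k i))) - ln (polar_fun (x i) (z l))| < 2 * g.
    move=> wz.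
    apply: (@le_lt_trans _ _ (2 * hilbert_dist (polar G) (w (k i)) (z l))).
      exact: (ln_pairing_le_hilbert_dist Gcompact G0 GK (Gx i) (Kw _) (Kz l)).
    by rewrite ltr_pM2l.
  have := near i (Hk i); have := Hk j; rewrite -kij => /near.
  rewrite !ltr_norml => /andP[j1 j2] /andP[i1 i2].
  by move: Hij sep; rewrite /H ag; lra.
have class_le c : (#|[set j | cls j == c]%SET| <= Mh)%N.
  apply: maxMh; set n := #|_|.
  (* Listing the class by decreasing index puts the later points first. *)
  pose s := [seq j <- rev (enum 'I_N) | cls j == c].
  have size_s : size s = n.
    rewrite /n -sum1dep_card -sum1_size big_filter.
    rewrite (perm_big (enum 'I_N)) ?perm_rev//=.
    by rewrite enumT unlock; reflexivity.
  have sorted_s : sorted (fun i j : 'I_N => (j < i)%N) s.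
    apply: sorted_filter; first by move=> ? ? ? /[swap]; exact: ltn_trans.
    rewrite rev_sorted.
    by have := iota_ltn_sorted 0 N; rewrite -val_enum_ord sorted_map.
  have [->|n_gt0] := posnP n; first exact: hilbert_convexified_packing0.
  have j0 : 'I_N.
    by move: n_gt0; rewrite /n card_gt0 => /set0Pn/cid[].
  have s_cls (i : 'I_n) : cls (nth j0 s i) = c.
    have : nth j0 s i \in s by rewrite mem_nth// size_s.
    by rewrite mem_filter => /andP[/eqP].
  apply: (hilbert_convexified_packing_of_witness Gcompact G0 GK
    (y := fun i : 'I_n => y (nth j0 s i))) => [i|j]; first exact: Ky.
  exists (x (nth j0 s j)) => // i ij.
  apply: key; last by rewrite !s_cls.
  apply: (sorted_ltn_nth _ _ sorted_s) => //; rewrite ?inE ?size_s//.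
  by move=> ? ? ? /[swap]; exact: ltn_trans.
rewrite -[N]card_ord -sum1_card (partition_big cls xpredT)//=.
apply: (@leq_trans (\sum_(c : 'I_M * 'I_(2 * Mh).+1) Mh)).
  by apply: leq_sum => c _; rewrite sum1dep_card.
rewrite sum_nat_const card_prod !card_ord.
apply: (@leq_trans (M * (3 * Mh) * Mh)); last first.
  by apply: eq_leq; rewrite -mulnn; ring.
by rewrite leq_mul2r leq_mul2l (mulnDl 2 1) mul1n -addn1 leq_add2l Mh0 !orbT.
Qed.

End PackingNumbers.

Theorem theorem1 (R : realType) :
  exists C c : R, [/\ 0 < C, 0 < c &
    forall (d : nat) (G K : set 'rV[R]_d) (alpha : R),
      (1 <= d)%N ->
      convex_body G -> convex_body K ->
      G° 0 -> G `<=` K° ->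
      0 < alpha ->
      (hilbert_convexified_packing_number G K alpha)%:R <=
        C * (hilbert_convexified_packing_number
               (polar K) (polar G) (c * alpha))%:R ^+ 2
          * (hilbert_packing_number (polar K) (polar G) (c * alpha))%:R].
Proof.
exists 3, 8^-1; split=> // d G K a _ [Gcompact Gconvex _] _ G0 GK a0.
rewrite /hilbert_convexified_packing_number /hilbert_packing_number.
have [->|packN] := max_nat_eq0_or (hilbert_convexified_packing G K a).
  by rewrite mulr_ge0// mulr_ge0// exprn_ge0.
have g0 : 0 < 8^-1 * a by rewrite mulr_gt0.
have [B HB] := hilbert_packing_bounded Gcompact G0 GK g0.
have [packM maxM] := max_nat_spec (hilbert_packing0 _ _ _) HB.
have [_ maxMh] := max_nat_spec (hilbert_convexified_packing0 _ _ _)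
  (fun n packn => HB n (hilbert_convexified_packing_sub packn)).
rewrite -natrX -!natrM ler_nat.
apply: (hilbert_convexified_packing_duality
  Gcompact Gconvex G0 GK a0 packN packM) => //.
by move=> /maxM; rewrite ltnn.
Qed.
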